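(* Let $n=n_1n_2$ where $n_1$ and $n_2$ are coprime positive integers such that $\Omega^*(n_1)\ge 2$ and $\Omega^*(n_2)\ge 2$. Then the cyclic group of order $n$ is not a Schur group.
   Context: For a positive integer $m$, $\Omega(m)$ denotes the total number of prime factors of $m$ counted with multiplicity, and $\Omega^*(m)=\Omega(m)$ if $m$ is odd, $\Omega^*(m)=\Omega(m/2)$ if $m$ is even. An S-ring over a finite group $G$ is a subring $\mathcal A$ of $\mathbb Z G$ spanned by the sums $\underline X=\sum_{x\in X}x$ over the blocks $X$ of a partition of $G$ (basic sets) containing $\{e\}$ and closed under $X\mapsto X^{-1}$. $\mathcal A$ is schurian if there is $\Gamma\le\mathrm{Sym}(G)$ containing all right translations such that the basic sets are the orbits of the stabilizer in $\Gamma$ of the identity; $G$ is a Schur group if every S-ring over $G$ is schurian. *)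

(* Defs.v *)
From HB Require Import structures.
From mathcomp Require Import all_boot all_order all_algebra all_fingroup all_solvable.

Set Implicit Arguments.
Unset Strict Implicit.
Unset Printing Implicit Defensive.

Import GRing.Theory.
Local Open Scope ring_scope.

Definition Omega (m : nat) : nat := (\sum_(p <- primes m) logn p m)%N.

Definition Omega_star (m : nat) : nat :=
  if odd m then Omega m else Omega (m %/ 2).

(* The integral group ring of gT. The alias keeps the convolution product
   apart from the pointwise product that finfuns carry. *)
Definition ZG (gT : finGroupType) : Type := {ffun gT -> int}.

HB.instance Definition _ (gT : finGroupType) :=
  GRing.Zmodule.copy (ZG gT) {ffun gT -> int}.

Section GroupRing.
Variable gT : finGroupType.
Implicit Types (x y : gT) (a b c : ZG gT).

Definition gelt x : ZG gT := [ffun y => (y == x)%:R].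

Definition conv a b : ZG gT := [ffun x => \sum_y a y * b (y^-1 * x)%g].

Fact convA : associative conv.
Proof.
move=> a b c; apply/ffunP=> x; rewrite !ffunE.
under eq_bigr => y _.
  rewrite ffunE mulr_sumr (reindex_inj (mulgI y^-1%g)) /=.
  under eq_bigr => z _ do rewrite invMg invgK -mulgA mulKVg mulrA.
  over.
rewrite exchange_big /=; apply: eq_bigr => z _.
by rewrite ffunE mulr_suml.
Qed.

Fact conv1l : left_id (gelt 1%g) conv.
Proof.
move=> a; apply/ffunP=> x; rewrite !ffunE (bigD1 1%g) //= big1 => [|y /negPf y1].
  by rewrite !ffunE eqxx mul1r invg1 mul1g addr0.
by rewrite ffunE y1 mul0r.
Qed.

Fact conv1r : right_id (gelt 1%g) conv.
Proof.
move=> a; apply/ffunP=> x; rewrite !ffunE (bigD1 x) //= big1 => [|y y1].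
  by rewrite !ffunE mulVg eqxx mulr1 addr0.
by rewrite ffunE -eq_mulVg1 (negPf y1) mulr0.
Qed.

Fact convDl : left_distributive conv +%R.
Proof.
move=> a b c; apply/ffunP=> x; rewrite !ffunE -big_split /=.
by apply: eq_bigr => y _; rewrite ffunE mulrDl.
Qed.

Fact convDr : right_distributive conv +%R.
Proof.
move=> a b c; apply/ffunP=> x; rewrite !ffunE -big_split /=.
by apply: eq_bigr => y _; rewrite ffunE mulrDr.
Qed.

Fact gelt1_neq0 : gelt 1%g != 0.
Proof. by apply/eqP=> /ffunP/(_ 1%g); rewrite !ffunE eqxx. Qed.

HB.instance Definition _ := GRing.Zmodule_isNzRing.Build (ZG gT)
  convA conv1l conv1r convDl convDr gelt1_neq0.

Lemma geltM x y : gelt (x * y)%g = gelt x * gelt y.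
Proof.
apply/ffunP=> z; rewrite !ffunE (bigD1 x) //= big1 => [|t /negPf tx].
  by rewrite !ffunE eqxx mul1r addr0 (can2_eq (mulKVg x) (mulKg x)).
by rewrite ffunE tx mul0r.
Qed.

Definition set_sum (X : {set gT}) : ZG gT := \sum_(x in X) gelt x.

Definition in_span (P : {set {set gT}}) a : Prop :=
  exists c : {set gT} -> int, a = \sum_(X in P) set_sum X *~ c X.

End GroupRing.

Record Sring (gT : finGroupType) := MkSring {
  sring_carrier : {pred ZG gT};
  basic_sets : {set {set gT}};
  sring_subring : subring_closed sring_carrier;
  basic_sets_partition : partition basic_sets [set: gT];
  basic_sets1 : [set 1%g] \in basic_sets;
  basic_setsV : forall X, X \in basic_sets -> (X^-1)%g \in basic_sets;
  sring_span : forall a, a \in sring_carrier <-> in_span basic_sets a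
}.

Definition right_translation (gT : finGroupType) (g : gT) : {perm gT} :=
  perm (@mulIg gT g).

Definition schurian (gT : finGroupType) (A : Sring gT) : Prop :=
  exists Gamma : {group {perm gT}},
    (forall g : gT, right_translation g \in Gamma) /\
    basic_sets A = [set orbit 'P 'C_Gamma[1%g | 'P] x | x : gT].

Definition Schur_group (gT : finGroupType) : Prop :=
  forall A : Sring gT, schurian A.

(* Main.v *)
(* Write [G = G1 * G2] with [G1], [G2] of orders [n1], [n2], and choose subgroups
   [Hi <= Pi < Gi] such that squares of [Pi] lie in [Hi] while [Pi] and [Gi / Hi]
   have order greater than 2: [Pi = Hi] of prime order if [ni] is odd, orders
   [2 * p] and [p] if [ni] is even; this is where [Omega_star ni >= 2] enters.
   Let [U1 = P1 * G2], [U2 = G1 * P2], and let [sigma] be the automorphism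
   inverting [G1] and fixing [G2]. The functions that are invariant under
   inversion, under [Hi] outside [Ui], and under [sigma] on [U1 \ U2] form an
   S-ring. If it were schurian, an automorphism [g] fixing 1 would send
   [p1 * q2] to [p1^-1 * q2], for generators [pi] of [Pi] and [qi] of [Gi]. The
   basic sets force [g] to act as an inversion or as the identity on each of the
   cyclic sections [<p1 * p2>], [<q1 * p2> / H1] and [<q1 * q2> / (H1 * H2)].
   Consecutive sections share [p2] and [q1], so the three signs agree; but
   [p1 * q2 |-> p1^-1 * q2] forces [g] to invert [p1] and to fix [q2] modulo
   [H1 * H2]. *)
Require Import Defs.
From mathcomp Require Import all_boot all_order all_algebra all_fingroup all_solvable.

Set Implicit Arguments.
Unset Strict Implicit.
Unset Printing Implicit Defensive.

(** * Coefficients of products and of set sums in the group ring *)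

Lemma convE (gT : finGroupType) (a b : ZG gT) (x : gT) :
  (a * b)%R x = (\sum_y a y * b (y^-1 * x)%g)%R.
Proof. by rewrite ffunE. Qed.

Lemma set_sumE (gT : finGroupType) (X : {set gT}) (x : gT) :
  set_sum X x = (x \in X)%:R%R.
Proof.
rewrite /set_sum sum_ffunE.
under eq_bigr do rewrite ffunE.
case: (boolP (x \in X)) => [xX | /negPf xX].
  rewrite (bigD1 x) //= eqxx big1 ?GRing.addr0 //.
  by move=> y /andP[_ /negPf yx]; rewrite eq_sym yx.
by rewrite big1 // => y yX; case: eqP => // xy; rewrite -xy xX in yX.
Qed.

(** * The S-ring of functions invariant under a relation *)

Section ConnectSring.

Variables (gT : finGroupType) (e : rel gT).

Definition rel_invariant (a : ZG gT) : bool :=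
  [forall x, forall y, e x y ==> (a x == a y)].

Lemma rel_invariantP (a : ZG gT) :
  reflect (forall x y, e x y -> a x = a y) (rel_invariant a).
Proof.
apply: (iffP forallP) => [inv x y exy | inv x].
  by have /forallP/(_ y)/implyP/(_ exy)/eqP := inv x.
by apply/forallP=> y; apply/implyP=> /inv ->.
Qed.

Lemma invariant_connect (a : ZG gT) (x y : gT) :
  rel_invariant a -> connect e x y -> a x = a y.
Proof.
move/rel_invariantP=> inv cxy.
have cl : closed e [pred z | a z == a x] by move=> u v /inv; rewrite !inE => ->.
by have := closed_connect cl cxy; rewrite !inE eqxx => /esym/eqP.
Qed.

Definition connect_classes : {set {set gT}} :=
  equivalence_partition (connect e) [set: gT].

Hypothesis e_sym : connect_sym e.
Hypothesis e_inv : forall x, connect e x x^-1%g.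
Hypothesis e_1 : closed e (pred1 1%g).
Hypothesis e_mul : forall a b : ZG gT,
  rel_invariant a -> rel_invariant b -> rel_invariant (a * b)%R.

Lemma connect_classesP (X : {set gT}) :
  reflect (exists x, X = [set y | connect e x y]) (X \in connect_classes).
Proof.
apply: (iffP imsetP) => [[x _ ->] | [x ->]]; exists x => //;
  by apply/setP=> y; rewrite !inE.
Qed.

Lemma connect_classes_connect (X : {set gT}) (x y : gT) :
  X \in connect_classes -> connect e x y -> (x \in X) = (y \in X).
Proof. by case/connect_classesP=> z -> cxy; rewrite !inE (same_connect_r e_sym cxy). Qed.

Lemma connect_classes_partition : partition connect_classes [set: gT].
Proof.
apply: equivalence_partitionP => x y z _ _ _; split; first exact: connect0.
by move=> cxy; apply: (same_connect e_sym cxy).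
Qed.

Lemma connect_classes1 : [set 1%g] \in connect_classes.
Proof.
apply/connect_classesP; exists 1%g; apply/setP=> x; rewrite !inE.
apply/eqP/idP => [-> | /(closed_connect e_1)]; first exact: connect0.
by rewrite !inE eqxx => /esym/eqP.
Qed.

Lemma connect_classesV (X : {set gT}) :
  X \in connect_classes -> (X^-1)%g \in connect_classes.
Proof.
move=> XP; suff -> : (X^-1)%g = X by [].
by apply/setP=> x; rewrite inE -(connect_classes_connect XP (e_inv x)).
Qed.

Lemma invariant_subring : GRing.subring_closed [pred a | rel_invariant a].
Proof.
split=> [|a b|a b]; rewrite ?inE; last exact: e_mul.
  by apply/rel_invariantP=> x y /e_1; rewrite !inE !ffunE => ->.
move=> /rel_invariantP ia /rel_invariantP ib; apply/rel_invariantP=> x y exy.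
by rewrite !ffunE (ia x y) ?(ib x y).
Qed.

Lemma invariant_span (a : ZG gT) :
  a \in [pred a | rel_invariant a] <-> in_span connect_classes a.
Proof.
have valE (c : {set gT} -> int) x :
    (\sum_(X in connect_classes) set_sum X *~ c X)%R x =
    (\sum_(X in connect_classes) (x \in X)%:R *~ c X)%R.
  rewrite sum_ffunE; apply: eq_bigr => X _.
  by case: (c X) => k; rewrite /intmul ?ffunE ffunMnE set_sumE.
split=> [inv_a | [c ->]].
  (* An invariant function is constant on each class, so its value at [repr X] serves as the
     coefficient of [X]. *)
  exists (fun X => a (repr X)); apply/ffunP=> x; rewrite valE.
  have xP : [set y | connect e x y] \in connect_classes.
    by apply/connect_classesP; exists x.
  rewrite (bigD1 _ xP) /= big1 => [|X /andP[XP nXx]].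
    rewrite inE connect0 GRing.addr0 intz; apply: invariant_connect inv_a _.
    have xX : x \in [set y | connect e x y] by rewrite inE connect0.
    by have := mem_repr x xX; rewrite inE.
  case: (boolP (x \in X)) => [xX | _]; last by rewrite mul0rz.
  case/connect_classesP: XP xX nXx => z ->; rewrite inE => czx /negP[].
  by apply/eqP/setP=> y; rewrite !inE; apply: (same_connect e_sym czx).
apply/rel_invariantP=> x y exy; rewrite !valE; apply: eq_bigr => X XP.
by rewrite (connect_classes_connect XP (connect1 exy)).
Qed.

Definition connect_Sring : Sring gT :=
  MkSring invariant_subring connect_classes_partition connect_classes1
    connect_classesV invariant_span.

(* Translating on both sides turns [gamma] into an element of the stabilizer
   of 1, whatever the base point [u]. *)
Lemma schurian_connect_Sring (x y : gT) :
  schurian connect_Sring -> connect e x y ->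
  exists gamma : {perm gT}, [/\ gamma 1%g = 1%g, gamma x = y &
    forall X : {pred gT}, closed e X -> forall u v,
      (gamma v * (gamma u)^-1 \in X)%g = (v * u^-1 \in X)%g].
Proof.
case=> Gamma [GammaR basicE] cxy.
have orbitE z t : (t \in orbit 'P 'C_Gamma[1%g | 'P] z) = connect e z t.
  have: orbit 'P 'C_Gamma[1%g | 'P] z \in connect_classes.
    by rewrite -[connect_classes]/(basic_sets connect_Sring) basicE imset_f.
  case/connect_classesP=> w ow; rewrite ow inE.
  have: z \in orbit 'P 'C_Gamma[1%g | 'P] z by exact: orbit_refl.
  by rewrite ow inE => cwz; rewrite (same_connect e_sym cwz).
have: y \in orbit 'P 'C_Gamma[1%g | 'P] x by rewrite orbitE.
case/orbitP=> gamma /setIP[gG /astab1P g1] gx.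
exists gamma; split=> // X clX u v.
pose d := (right_translation u * gamma * right_translation (gamma u)^-1)%g.
have dE z : d z = (gamma (z * u) * (gamma u)^-1)%g by rewrite !permM !permE.
have dS : d \in 'C_Gamma[1%g | 'P]%g.
  apply/setIP; split; first by rewrite !groupM ?GammaR.
  by apply/astab1P; rewrite -[LHS]/(d 1%g) dE mul1g mulgV.
have := mem_orbit 'P (v * u^-1)%g dS.
rewrite -[X in X \in _]/(d (v * u^-1)%g) dE mulgKV orbitE => cd.
by rewrite -(closed_connect clX cd).
Qed.

End ConnectSring.

(** * The relation behind the counterexample and its stability under convolution *)

Section Link.

Local Open Scope group_scope.

Variables (gT : finGroupType) (U1 U2 H1 H2 : {group gT}) (s : nat).

(* The map [x |-> x ^+ s] is the automorphism [sigma] above. *)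
Definition link (x y : gT) : bool :=
  [|| y == x^-1,
      (x \notin U1) && (x^-1 * y \in H1),
      (x \notin U2) && (x^-1 * y \in H2) |
      [&& x \in U1, x \notin U2 & y == x ^+ s]].

Implicit Types x y h : gT.

Hypothesis mulC : commutative (@mulg gT).
Hypothesis sH1U1 : H1 \subset U1.
Hypothesis sH2U2 : H2 \subset U2.
Hypothesis expsK : forall x : gT, x ^+ s ^+ s = x.
(** On [U1] the map [sigma] is trivial modulo [H1], and on [U2] it is inversion modulo [H2]; shifts
    by [H1] and [H2] can thus compensate for it. *)
Hypothesis U1_exps : forall x, x \in U1 -> x^-1 * x ^+ s \in H1.
Hypothesis U2_exps : forall x, x \in U2 -> x * x ^+ s \in H2.

Lemma mem_exps (U : {group gT}) (x : gT) : (x ^+ s \in U) = (x \in U).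
Proof. by apply/idP/idP=> xU; rewrite ?groupX // -[x]expsK groupX. Qed.

Lemma exps_inj : injective (fun x : gT => x ^+ s).
Proof. exact: (inv_inj expsK). Qed.

Lemma exps_mul (x y : gT) : (x * y) ^+ s = x ^+ s * y ^+ s.
Proof. by rewrite expgMn //; apply: mulC. Qed.

Lemma mem_shift (H U : {group gT}) (x y : gT) :
  H \subset U -> x^-1 * y \in H -> (x \in U) = (y \in U).
Proof. by move=> sHU /(subsetP sHU) xyU; rewrite -[y](mulKVg x) groupMr. Qed.

Lemma link_sym : symmetric link.
Proof.
have imp x y : link x y -> link y x.
  case/or4P=> [/eqP-> | /andP[xU xyH] | /andP[xU xyH] | /and3P[xU1 xU2 /eqP->]].
  - by rewrite /link invgK eqxx.
  - by apply/or4P/Or42; rewrite -(mem_shift sH1U1 xyH) xU -groupV invMg invgK.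
  - by apply/or4P/Or43; rewrite -(mem_shift sH2U2 xyH) xU -groupV invMg invgK.
  - by apply/or4P/Or44; rewrite !mem_exps xU1 xU2 expsK eqxx.
by move=> x y; apply/idP/idP; apply: imp.
Qed.

Lemma link_connect_sym : connect_sym link.
Proof. exact: (sym_connect_sym link_sym). Qed.

Lemma closed_link (X : {pred gT}) :
  (forall x, x \in X -> x^-1 \in X) ->
  (forall x h, x \notin U1 -> h \in H1 -> x \in X -> x * h \in X) ->
  (forall x h, x \notin U2 -> h \in H2 -> x \in X -> x * h \in X) ->
  (forall x, x \in U1 -> x \notin U2 -> x \in X -> x ^+ s \in X) ->
  closed link X.
Proof.
move=> XV X1 X2 Xs; apply: intro_closed; first exact: link_connect_sym.
move=> x y /or4P[/eqP-> | /andP[xU xyH] | /andP[xU xyH] | /and3P[? ? /eqP->]] xX.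
- exact: XV.
- by rewrite -[y](mulKVg x); apply: X1.
- by rewrite -[y](mulKVg x); apply: X2.
- exact: Xs.
Qed.

Lemma closed_link_sub (X : {pred gT}) :
  (forall x, x \in X -> x^-1 \in X) -> {subset X <= U1} -> {subset X <= U2} ->
  closed link X.
Proof.
move=> XV sXU1 sXU2; apply: closed_link => // x.
- by move=> h /negP xU _ /sXU1.
- by move=> h /negP xU _ /sXU2.
- by move=> _ /negP xU /sXU2.
Qed.

(** As [K] lies in [U1] and [U2], membership in either is the same for all elements of this set as
    for [t]. The hypotheses on [t] therefore leave only inversion and shifts by elements of [K]. *)
Lemma closed_link_pm_coset (K : {group gT}) (t : gT) :
  K \subset U1 -> K \subset U2 ->
  (t \in U1) || (H1 \subset K) -> (t \in U2) || (H2 \subset K) ->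
  (t \in U1) ==> (t \in U2) ->
  closed link [pred y | (y * t^-1 \in K) || (y * t \in K)].
Proof.
move=> sKU1 sKU2 t1 t2 t12.
pose X := [pred y : gT | (y * t^-1 \in K) || (y * t \in K)].
have memX (U : {group gT}) x : K \subset U -> x \in X -> (x \in U) = (t \in U).
  move=> /subsetP sKU /orP[] /sKU xtU; first by rewrite -(groupMl t xtU) mulgKV.
  by rewrite -[t \in U]groupV -(groupMl t^-1 xtU) mulgK.
have shift x h : h \in K -> x \in X -> x * h \in X.
  by move=> hK; rewrite !inE !(mulC x h) -!mulgA !(groupMl _ hK).
apply: closed_link => x.
- rewrite !inE orbC -[x^-1 * t \in K]groupV -[x^-1 * t^-1 \in K]groupV.
  by rewrite !invMg !invgK !(mulC _ x).
- move=> h xU hH xX; apply: shift => //; move: t1.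
  by rewrite -(memX U1 x) // (negPf xU) /= => /subsetP; apply.
- move=> h xU hH xX; apply: shift => //; move: t2.
  by rewrite -(memX U2 x) // (negPf xU) /= => /subsetP; apply.
- by move=> xU1 xU2 xX; move: t12; rewrite -!(memX _ x) // xU1 (negPf xU2).
Qed.

Lemma link1 : closed link (pred1 1).
Proof. by apply: closed_link_sub => x; rewrite !inE ?invg_eq1 // => /eqP->. Qed.

Section Convolution.

Local Open Scope ring_scope.

Variables a b : ZG gT.
Hypotheses (inv_a : rel_invariant link a) (inv_b : rel_invariant link b).

Lemma invariant_linkV (c : ZG gT) x : rel_invariant link c -> c x^-1%g = c x.
Proof. by move/rel_invariantP=> inv; apply: inv; rewrite /link invgK eqxx. Qed.

Lemma invariant_link1 (c : ZG gT) x h :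
  rel_invariant link c -> x \notin U1 -> h \in H1 -> c (x * h)%g = c x.
Proof. by move/rel_invariantP=> inv xU hH; apply/esym/inv;
  rewrite /link xU mulKg hH orbT. Qed.

Lemma invariant_link2 (c : ZG gT) x h :
  rel_invariant link c -> x \notin U2 -> h \in H2 -> c (x * h)%g = c x.
Proof. by move/rel_invariantP=> inv xU hH; apply/esym/inv;
  rewrite /link xU mulKg hH !orbT. Qed.

Lemma invariant_links (c : ZG gT) x :
  rel_invariant link c -> x \in U1 -> x \notin U2 -> c (x ^+ s)%g = c x.
Proof. by move/rel_invariantP=> inv xU1 xU2; apply/esym/inv;
  rewrite /link xU1 xU2 eqxx !orbT. Qed.

(** When [y] lies in [U], the second factor has its argument outside [U] and absorbs [h]; otherwise
    the substitution of [y * h] for [y] lets the first factor absorb it. *)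
Lemma conv_shift (U H : {group gT}) x h :
  H \subset U ->
  (forall (c : ZG gT) y k,
     rel_invariant link c -> y \notin U -> k \in H -> c (y * k)%g = c y) ->
  x \notin U -> h \in H -> (a * b) (x * h)%g = (a * b) x.
Proof.
move=> sHU invH xU hH; rewrite !convE (bigID (mem U)) [RHS](bigID (mem U)) /=.
congr (_ + _).
  apply: eq_bigr => y yU; congr (_ * _).
  by rewrite mulgA invH // groupMl ?groupV.
rewrite (reindex_inj (mulIg h)) /=; apply: eq_big => [y | y yU].
  by rewrite groupMr ?(subsetP sHU h hH).
rewrite groupMr ?(subsetP sHU h hH) // in yU.
rewrite /=. by rewrite (invH a) // (mulC y) (mulC x) invMg -mulgA mulKg.
Qed.

(* On [U1 :&: U2] the function [c] need not be invariant under [x |-> x ^+ s];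
   inverting its argument instead costs an element of [H2], which [d] absorbs. *)
Lemma conv_exps_mid (c d : ZG gT) x :
  rel_invariant link c -> rel_invariant link d -> x \in U1 -> x \notin U2 ->
  \sum_(y in U1 | y \in U2) c y * d (y^-1 * x ^+ s)%g =
  \sum_(y in U1 | y \in U2) c y * d (y^-1 * x)%g.
Proof.
move=> inv_c inv_d xU1 xU2; rewrite [LHS](reindex_inj invg_inj) /=.
apply: eq_big => [y | y]; first by rewrite !groupV.
rewrite !groupV invgK => /andP[yU1 yU2]; rewrite invariant_linkV //; congr (_ * _).
have yxU1 : (y^-1 * x)%g \in U1 by rewrite groupMl ?groupV.
have yxU2 : (y^-1 * x)%g \notin U2 by rewrite groupMl ?groupV.
rewrite -[RHS](invariant_links inv_d yxU1 yxU2) exps_mul expgVn.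
rewrite -[RHS](invariant_link2 inv_d _ (U2_exps yU2)).
  by rewrite (mulC y (y ^+ s)%g) (mulC (_^-1)%g) -mulgA mulKg mulC.
by rewrite groupMl ?groupV ?mem_exps.
Qed.

(** The substitution of [y^-1 * t] for [y] exchanges the two factors and turns this range into the
    one of [conv_exps_mid]. *)
Lemma conv_flip t : t \in U1 -> t \notin U2 ->
  \sum_(y | (y \in U1) && (y \notin U2) && ((y^-1 * t)%g \in U2)) a y * b (y^-1 * t)%g =
  \sum_(y in U1 | y \in U2) b y * a (y^-1 * t)%g.
Proof.
move=> tU1 tU2; rewrite (reindex_inj (inj_comp (mulIg t) invg_inj)) /=.
have flipK y : ((y^-1 * t)^-1 * t)%g = y by rewrite invMg invgK (mulC t^-1%g) mulgKV.
apply: eq_big => [y | y _]; last by rewrite flipK GRing.mulrC.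
rewrite flipK groupMr // groupV -andbA; congr (_ && _); apply: andb_idl => yU2.
by rewrite groupMl ?groupV.
Qed.

(** The sum splits into four ranges. For [y] outside [U1], the factor [b] absorbs [x^-1 * x ^+ s].
    In [U1], if [y] or [y^-1 * x] lies in [U2], [conv_exps_mid] applies, after a flip in the second
    case. If neither does, both factors are invariant under [sigma], which reindexes the sum. *)
Lemma conv_exps x : x \in U1 -> x \notin U2 -> (a * b) (x ^+ s)%g = (a * b) x.
Proof.
move=> xU1 xU2; rewrite !convE (bigID (mem U1)) [RHS](bigID (mem U1)) /=.
congr (_ + _); last first.
  apply: eq_bigr => y yU; congr (_ * _).
  rewrite -[(x ^+ s)%g](mulKVg x) mulgA (invariant_link1 inv_b) ?U1_exps //.
  by rewrite groupMr ?groupV.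
rewrite (bigID (mem U2)) [RHS](bigID (mem U2)) /=; congr (_ + _).
  exact: conv_exps_mid.
rewrite (bigID (fun y => (y^-1 * x ^+ s)%g \in U2)) /=.
rewrite [RHS](bigID (fun y => (y^-1 * x)%g \in U2)) /=; congr (_ + _).
  by rewrite !conv_flip ?mem_exps // conv_exps_mid.
rewrite (reindex_inj exps_inj) /=; apply: eq_big => [y | y].
  by rewrite -expgVn -exps_mul !mem_exps.
rewrite -expgVn -exps_mul !mem_exps => /andP[/andP[yU1 yU2] yxU2].
by rewrite !invariant_links // groupMl ?groupV.
Qed.

Lemma rel_invariant_conv : rel_invariant link (a * b).
Proof.
apply/rel_invariantP=> x y.
case/or4P=> [/eqP-> | /andP[xU xyH] | /andP[xU xyH] | /and3P[xU1 xU2 /eqP->]].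
- rewrite !convE [RHS](reindex_inj invg_inj) /=; apply: eq_bigr => z _.
  rewrite invariant_linkV // -[in RHS](invariant_linkV _ inv_b).
  by rewrite invMg !invgK mulC.
- by rewrite -[y](mulKVg x) (conv_shift sH1U1) // => c *; apply: invariant_link1.
- by rewrite -[y](mulKVg x) (conv_shift sH2U2) // => c *; apply: invariant_link2.
- by rewrite conv_exps.
Qed.

End Convolution.
End Link.

(** * Walks on a cyclic group and the rigidity of signs *)

Section Walk.

Local Open Scope group_scope.

Variable gT : finGroupType.
Implicit Types (x s : gT) (b : bool).

Definition inv_if b x := if b then x^-1 else x.

Lemma inv_ifX b x k : inv_if b x ^+ k = inv_if b (x ^+ k).
Proof. by case: b => //=; rewrite expgVn. Qed.

(** Turning back gives [f k.+2 = f k], hence [s ^+ 2 = 1]; then both steps coincide, so the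
    direction of the first step can be kept throughout. *)
Lemma two_sided_walk (f : nat -> gT) s :
  f 0 = 1 -> (forall k, f k.+1 = f k * s \/ f k.+1 = f k * s^-1) ->
  (forall k, f k.+2 = f k -> s ^+ 2 = 1) ->
  exists b, forall k, f k = inv_if b s ^+ k.
Proof.
move=> f0 fS fSS; have [b f1] : exists b, f 1%N = inv_if b s.
  by case: (fS 0); rewrite f0 mul1g => ->; [exists false | exists true].
exists b => k; suff [] : f k = inv_if b s ^+ k /\ f k.+1 = inv_if b s ^+ k.+1 by [].
elim: k => [|k [IHk IHk1]]; first by rewrite f0 f1 expg1.
split=> //; rewrite expgSr -IHk1.
have back : f k.+2 = f k.+1 * (inv_if b s)^-1 -> f k.+2 = f k.+1 * inv_if b s.
  move=> fk2; suff sV : s^-1 = s by rewrite fk2; case: (b) => /=; rewrite ?invgK sV.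
  apply/eqP; rewrite eq_invg_mul -expg2; apply/eqP/(fSS k).
  by rewrite fk2 IHk1 expgSr mulgK.
case: b {f1 IHk IHk1} back (fS k.+1) => /=; rewrite ?invgK => back.
  by case=> [/back | ].
by case=> [| /back].
Qed.

End Walk.

Section Rigidity.

Local Open Scope group_scope.

Variable gT : finGroupType.
Implicit Types (K : {group gT}) (x y z s : gT) (b c : bool).

Hypothesis mulC : commutative (@mulg gT).

Lemma normal_all K x : x \in 'N(K).
Proof. by rewrite inE; apply/subsetP=> _ /imsetP[y yK ->]; rewrite conjgE mulC mulgK. Qed.

Lemma eq_coset K x y : (coset K x == coset K y) = (x * y^-1 \in K).
Proof.
rewrite -mem_rcoset.
exact: (sameP eqP (rcoset_kercosetP (normal_all K x) (normal_all K y))).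
Qed.

(** Modulo [K], the images under [g] of the successive powers of [s] form a two-sided walk. Since
    [g] is injective modulo [K], turning back would put [s ^+ 2] in [K]. *)
Lemma cycle_rigid K (g : gT -> gT) s :
  g 1 = 1 ->
  (forall x y, (g y * (g x)^-1 \in K) = (y * x^-1 \in K)) ->
  (forall x, g (x * s) * (g x)^-1 * s^-1 \in K \/ g (x * s) * (g x)^-1 * s \in K) ->
  exists b, {in <[s]>, forall z, g z * (inv_if b z)^-1 \in K}.
Proof.
move=> g1 gK gs.
have cM (x y : gT) : coset K (x * y) = coset K x * coset K y.
  by rewrite morphM ?normal_all.
have cX (x : gT) k : coset K (x ^+ k) = coset K x ^+ k by rewrite morphX ?normal_all.
have cV (x : gT) : coset K x^-1 = (coset K x)^-1 by rewrite morphV ?normal_all.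
have c_inv_if b (x : gT) : coset K (inv_if b x) = inv_if b (coset K x) by case: b => //=.
have [|k|k|b gE] := @two_sided_walk _ (fun k => coset K (g (s ^+ k))) (coset K s).
- by rewrite g1 morph1.
- rewrite expgSr -cV -!cM; case: (gs (s ^+ k)) => sK; [left | right]; apply/eqP.
    by rewrite eq_coset invMg (mulC s^-1) mulgA.
  by rewrite eq_coset invMg invgK (mulC s) mulgA.
- move/eqP; rewrite eq_coset gK -addn2 (addnC k) expgD mulgK => s2K.
  by rewrite -cX; apply: coset_id.
exists b => _ /cycleP[k ->]; rewrite -eq_coset; apply/eqP.
by rewrite gE c_inv_if cX inv_ifX.
Qed.

(** Distinct signs would leave [z ^+ 2] or its inverse in [K] after division. *)
Lemma inv_if_unique K x z b c :
  x * (inv_if b z)^-1 \in K -> x * (inv_if c z)^-1 \in K -> z ^+ 2 \notin K -> b = c.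
Proof.
move=> xb xc; have := groupM (groupVr xb) xc.
rewrite invMg invgK -mulgA mulKg.
by case: b c {xb xc} => [] []; rewrite //= ?invgK expg2 => zK /negP[] //;
  rewrite -groupV invMg.
Qed.

End Rigidity.

(** * Choice of the subgroup orders from the number of prime factors *)

Section Omega.
Lemma Omega_prime p : prime p -> Omega p = 1.
Proof. by move=> pr; rewrite /Omega primes_prime // big_seq1 logn_prime // eqxx. Qed.

Lemma Omega_ge2 m : 1 < Omega m -> exists2 p, prime p & p %| m /\ p < m.
Proof.
move=> Om; have [m1|m_le1] := ltnP 1 m; last first.
  by case: m m_le1 Om => [|[]] //; rewrite /Omega big_nil.
exists (pdiv m); first exact: pdiv_prime.
split; first exact: pdiv_dvd.
rewrite ltn_neqAle pdiv_leq ?(ltnW m1) // andbT; apply: contraL Om => /eqP mp.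
by rewrite Omega_prime // -mp pdiv_prime.
Qed.

(** Here [d] and [h] are the orders of [Pi] and [Hi]. The condition [d %| 2 * h] puts the squares of
    [Pi] in [Hi]; [2 < d] and [2 * h < n] keep signs on [Pi] and on [Gi / Hi] distinguishable. *)
Lemma Omega_star_ge2 n : 0 < n -> 1 < Omega_star n ->
  exists h d, [/\ h %| d, d %| n, d %| 2 * h & [/\ 2 < d, d < n & 2 * h < n]].
Proof.
move=> n0; rewrite /Omega_star; case: ifP => [on | /negbT en] /Omega_ge2[p pr [pn ltpn]].
  exists p, p; rewrite pn dvdn_mull //; split=> //; split=> //.
    rewrite odd_prime_gt2 //; exact: dvdn_odd pn on.
  case/dvdnP: pn on ltpn => k ->; rewrite oddM => /andP[ok op].
  (* The cofactor [k] is odd and exceeds 1, hence is at least 3. *)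
  rewrite -{1}[p]mul1n !ltn_pmul2r ?prime_gt0 //.
  by case: k ok => [|[|[|]]].
have : n = 2 * (n %/ 2) by rewrite mulnC divnK // dvdn2.
move: (n %/ 2) pn ltpn => m pm ltpm ->.
exists p, (2 * p); rewrite dvdn_mull // dvdn_pmul2l // pm dvdnn !ltn_pmul2l //.
by rewrite ltpm (@ltn_pmul2l 2 1) ?prime_gt1.
Qed.
End Omega.

(** * Subgroups given by the orders of their elements *)

Section Torsion.

Local Open Scope group_scope.

Variable gT : finGroupType.
Hypothesis mulC : commutative (@mulg gT).

Lemma torsion_group_set m : group_set [set x : gT | #[x] %| m].
Proof.
apply/group_setP; split=> [|x y]; first by rewrite inE order1 dvd1n.
by rewrite !inE !order_dvdn => /eqP xm /eqP ym; rewrite expgMn ?xm ?ym ?mulg1.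
Qed.

(** In a cyclic group every subgroup has this form, so that inclusions reduce to divisibility. *)
Definition torsion m : {group gT} := Group (torsion_group_set m).

Lemma mem_torsion m x : (x \in torsion m) = (#[x] %| m).
Proof. by rewrite inE. Qed.

Lemma torsionX m k x : (x ^+ k \in torsion m) = (#[x] %| k * m).
Proof. by rewrite mem_torsion !order_dvdn expgM. Qed.

Lemma torsionS m k : m %| k -> torsion m \subset torsion k.
Proof. by move=> mk; apply/subsetP=> x; rewrite !mem_torsion => /dvdn_trans; apply. Qed.

End Torsion.

Lemma exists_order (gT : finGroupType) m :
  cyclic [set: gT] -> m %| #|[set: gT]| -> exists x : gT, #[x]%g = m.
Proof.
case/cyclicP=> g gE; rewrite gE => /dvdnP[k gk]; exists (g ^+ k)%g.
have ord_g : #[g]%g = k * m by exact: gk.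
have k0 : 0 < k by move: (order_gt0 g); rewrite ord_g; case: (k).
by rewrite orderXdiv ord_g ?dvdn_mulr // mulKn.
Qed.

(** * The S-ring over the cyclic group and the contradiction *)

Section NonSchur.

Local Open Scope group_scope.

Variables (gT : finGroupType) (n1 n2 d1 d2 h1 h2 : nat).
Hypotheses (cycG : cyclic [set: gT]) (cardG : #|[set: gT]| = (n1 * n2)%N).
Hypothesis co_n12 : coprime n1 n2.
Hypotheses (h1_dvd : h1 %| d1) (d1_dvd : d1 %| n1) (d1_dvd2 : d1 %| 2 * h1).
Hypotheses (d1_gt2 : 2 < d1) (d1_lt : d1 < n1) (h1_lt : 2 * h1 < n1).
Hypotheses (h2_dvd : h2 %| d2) (d2_dvd : d2 %| n2) (d2_dvd2 : d2 %| 2 * h2).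
Hypotheses (d2_gt2 : 2 < d2) (d2_lt : d2 < n2) (h2_lt : 2 * h2 < n2).

Let mulC : commutative (@mulg gT).
Proof. by move=> x y; apply: (centsP (cyclic_abelian cycG)); rewrite inE. Qed.

Let co12 a b : a %| n1 -> b %| n2 -> coprime a b.
Proof. by move=> an bn; apply: coprime_dvdl an (coprime_dvdr bn co_n12). Qed.

Let h1n : h1 %| n1. Proof. exact: dvdn_trans d1_dvd. Qed.
Let h2n : h2 %| n2. Proof. exact: dvdn_trans d2_dvd. Qed.

Let T m := torsion mulC m.

(** The exponent [r.+1] is 1 modulo [n2] and -1 modulo [n1], so raising to it is [sigma]. *)
Lemma exists_partial_inversion : exists r, n2 %| r /\ n1 %| r.+2.
Proof.
have n1_gt2 : 2 < n1 by apply: ltn_trans d1_lt.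
exists (chinese n1 n2 (n1 - 2) 0); split.
  by rewrite /dvdn chinese_modr // mod0n.
by rewrite -addn2 /dvdn -modnDml chinese_modl // modnDml subnK ?modnn // ltnW.
Qed.

Lemma torsion_not_Schur : ~ Schur_group gT.
Proof.
have [r [n2r n1r]] := exists_partial_inversion.
pose s := r.+1; pose U1 := T (d1 * n2); pose U2 := T (n1 * d2).
have order_dvd (x : gT) : #[x] %| n1 * n2 by rewrite -cardG order_dvdG ?inE.
have sH1U1 : T h1 \subset U1 by rewrite torsionS // dvdn_mulr.
have sH2U2 : T h2 \subset U2 by rewrite torsionS // dvdn_mull.
have expsK (x : gT) : x ^+ s ^+ s = x.
  have ss : (s * s = (r * r.+2).+1)%N by rewrite mulnS mulSn.
  have /eqP rr : x ^+ (r * r.+2) == 1.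
    by rewrite -order_dvdn mulnC (dvdn_trans (order_dvd x)) // dvdn_mul.
  by rewrite -expgM ss expgS rr mulg1.
have U1_exps x : x \in U1 -> x^-1 * x ^+ s \in T h1.
  rewrite mem_torsion expgS mulKg torsionX => /dvdn_trans; apply.
  rewrite Gauss_dvd ?co12 // andbC (dvdn_mulr _ n2r) /=.
  (* Since [d1] divides [2 * h1], it divides [r * h1] exactly when it divides [r.+2 * h1]. *)
  by rewrite -(dvdn_addl (r * h1) d1_dvd2) -mulnDl addn2 dvdn_mulr // (dvdn_trans d1_dvd).
have U2_exps x : x \in U2 -> x * x ^+ s \in T h2.
  rewrite mem_torsion -expgS torsionX => /dvdn_trans; apply.
  rewrite Gauss_dvd ?co12 // (dvdn_mulr _ n1r) /=.
  by rewrite -addn2 mulnDl (dvdn_addl _ d2_dvd2) dvdn_mulr // (dvdn_trans d2_dvd).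
pose e := link U1 U2 (T h1) (T h2) s.
have e_sym : connect_sym e by apply: link_connect_sym.
have e_V x : connect e x x^-1 by apply: connect1; rewrite /e /link eqxx.
have e_1 : closed e (pred1 1) by apply: link1.
have e_conv a b : rel_invariant e a -> rel_invariant e b -> rel_invariant e (a * b)%R.
  exact: rel_invariant_conv.
move/(_ (connect_Sring e_sym e_V e_1 e_conv)) => schur.
have ord m : m %| n1 * n2 -> exists x : gT, #[x] = m.
  by rewrite -cardG; apply: exists_order.
have [|p1 p1o] := ord d1; first by rewrite dvdn_mulr.
have [|p2 p2o] := ord d2; first by rewrite dvdn_mull.
have [|q1 q1o] := ord n1; first by rewrite dvdn_mulr.
have [|q2 q2o] := ord n2; first by rewrite dvdn_mull.
have order_mul (a b : gT) : #[a] %| n1 -> #[b] %| n2 -> #[a * b] = (#[a] * #[b])%N.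
  by move=> an bn; rewrite orderM ?co12 //; apply: mulC.
have cycle_mul (a b : gT) : #[a] %| n1 -> #[b] %| n2 ->
    a \in <[a * b]> /\ b \in <[a * b]>.
  move=> an bn; rewrite cycleM ?co12 //.
  split; first by apply: (subsetP (mulG_subl _ _)); rewrite cycle_id.
  by apply: (subsetP (mulG_subr _ _)); rewrite cycle_id.
have dvdnF a b : 0 < b -> b < a -> a %| b = false by move=> b0 ba; rewrite gtnNdvd.
have d1_gt0 : 0 < d1 by apply: ltn_trans d1_gt2.
have d2_gt0 : 0 < d2 by apply: ltn_trans d2_gt2.
have n2_gt0 : 0 < n2 by apply: ltn_trans d2_lt.
have h1_gt0 : 0 < h1 by apply: dvdn_gt0 h1_dvd.
have h2_gt0 : 0 < h2 by apply: dvdn_gt0 h2_dvd.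
pose u := p1 * q2.
have uU1 : u \in U1 by rewrite mem_torsion order_mul ?p1o ?q2o.
have uU2 : u \notin U2.
  rewrite mem_torsion order_mul ?p1o ?q2o // Gauss_dvd ?co12 // negb_and orbC.
  by rewrite Gauss_dvdr 1?coprime_sym // dvdnF.
have us : u ^+ s = p1^-1 * q2.
  have /eqP p1r : p1 ^+ r.+2 == 1 by rewrite -order_dvdn p1o (dvdn_trans d1_dvd).
  have /eqP q2r : q2 ^+ r == 1 by rewrite -order_dvdn q2o.
  rewrite expgMn; last exact: mulC.
  congr (_ * _); last by rewrite expgSr q2r mul1g.
  by apply/eqP; rewrite eq_sym eq_invg_mul -expgS p1r.
have [g [g1 gu gX]] : exists g : {perm gT}, [/\ g 1 = 1, g u = p1^-1 * q2 &
    forall X : {pred gT}, closed e X ->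
      forall x y, (g y * (g x)^-1 \in X) = (y * x^-1 \in X)].
  apply: (schurian_connect_Sring schur); apply: connect1.
  by rewrite -us /e /link uU1 uU2 eqxx !orbT.
have gK (K : {group gT}) : K \subset U1 -> K \subset U2 ->
    forall x y, (g y * (g x)^-1 \in K) = (y * x^-1 \in K).
  move=> sKU1 sKU2; apply: gX; apply: closed_link_sub => // [x|x|x].
  - by rewrite groupV.
  - exact: (subsetP sKU1).
  - exact: (subsetP sKU2).
(* The side conditions are those of [closed_link_pm_coset] for [t = a * b] and [K = T m]. By
   coprimality [<[a * b]>] contains both [a] and [b], which therefore share one sign. *)
have sign m a b : #[a] %| n1 -> #[b] %| n2 ->
    m %| d1 * n2 -> m %| n1 * d2 ->
    (#[a] * #[b] %| d1 * n2) || (h1 %| m) -> (#[a] * #[b] %| n1 * d2) || (h2 %| m) ->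
    (#[a] * #[b] %| d1 * n2) ==> (#[a] * #[b] %| n1 * d2) ->
    exists c, g a * (inv_if c a)^-1 \in T m /\ g b * (inv_if c b)^-1 \in T m.
  move=> an bn m1 m2; rewrite -order_mul // -!(mem_torsion mulC) => ab1 ab2 ab12.
  have K1 : T m \subset U1 by apply: torsionS.
  have K2 : T m \subset U2 by apply: torsionS.
  have [x|c gc] := cycle_rigid mulC (s := a * b) g1 (gK _ K1 K2).
    apply/orP; rewrite -[_ || _]/(_ \in [pred y |
      (y * (a * b)^-1 \in T m) || (y * (a * b) \in T m)]).
    rewrite gX; first by rewrite inE (mulC x) mulgK mulgV group1.
    apply: closed_link_pm_coset => //.
      by case/orP: ab1 => [-> // | /(torsionS mulC)->]; rewrite orbT.
    by case/orP: ab2 => [-> // | /(torsionS mulC)->]; rewrite orbT.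
  by exists c; have [a_ab b_ab] := cycle_mul a b an bn; split; apply: gc.
have [c1 [gp1 gp2]] :
    exists c, g p1 * (inv_if c p1)^-1 \in T 1 /\ g p2 * (inv_if c p2)^-1 \in T 1.
  by apply: sign; rewrite ?p1o ?p2o ?dvd1n // !dvdn_mul.
have [c2 [gq1 gp2']] :
    exists c, g q1 * (inv_if c q1)^-1 \in T h1 /\ g p2 * (inv_if c p2)^-1 \in T h1.
  by apply: sign; rewrite ?q1o ?p2o ?dvdnn ?orbT ?implybT // dvdn_mulr.
have [c3 [gq1' gq2]] :
    exists c, g q1 * (inv_if c q1)^-1 \in T (h1 * h2) /\
      g q2 * (inv_if c q2)^-1 \in T (h1 * h2).
  apply: sign; rewrite ?q1o ?q2o ?(dvdn_mulr _ (dvdnn h1)) ?(dvdn_mull _ (dvdnn h2)) ?orbT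
    ?(dvdn_mul h1_dvd h2n) ?(dvdn_mul h1n h2_dvd) //.
  (* The remaining implication is vacuous: [q1 * q2] is not in [U1], because [n1] does not divide
     [d1]. *)
  by rewrite dvdn_pmul2r ?(dvdnF n1).
have c12 : c1 = c2.
  apply: (inv_if_unique _ gp2' (z := p2)).
    by apply: (subsetP _ _ gp2); rewrite torsionS ?dvd1n.
  by rewrite torsionX p2o Gauss_dvdl ?dvdnF // coprime_sym co12.
have c23 : c2 = c3.
  apply: (inv_if_unique _ gq1' (z := q1)).
    by apply: (subsetP _ _ gq1); rewrite torsionS ?dvdn_mulr.
  by rewrite torsionX q1o mulnA Gauss_dvdl ?co12 // dvdnF // muln_gt0.
(* [G2] lies in [U1], which excludes shifts by [H1], and it contains [H2]; the situation of [G1] is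
   symmetric. *)
have G2closed : closed e (mem (T n2)).
  apply: closed_link => // x; first by rewrite groupV.
  - by move=> h /negP xU1 _ xT; case: xU1; apply: (subsetP _ _ xT);
      rewrite torsionS ?dvdn_mull.
  - by move=> h _ hH xT; rewrite groupM //; apply: (subsetP _ _ hH); rewrite torsionS.
  - by move=> _ _; apply: groupX.
have G1closed : closed e (mem (T n1)).
  apply: closed_link => // x; first by rewrite groupV.
  - by move=> h _ hH xT; rewrite groupM //; apply: (subsetP _ _ hH); rewrite torsionS.
  - by move=> h /negP xU2 _ xT; case: xU2; apply: (subsetP _ _ xT);
      rewrite torsionS ?dvdn_mulr.
  - by move=> _ _; apply: groupX.
(* Closedness of [G2] gives that [g u] and [g p1] agree modulo [G2], and [g u] is [p1^-1 * q2]. *)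
have c1_true : c1 = true.
  apply: (inv_if_unique (K := T n2) (x := g p1) (z := p1)).
  - by apply: (subsetP _ _ gp1); rewrite torsionS ?dvd1n.
  - have q2T : q2 \in T n2 by rewrite mem_torsion q2o.
    have: g u * (g p1)^-1 \in T n2.
      by apply: etrans (gX _ G2closed p1 u) _; rewrite /u (mulC p1) mulgK.
    rewrite gu (mulC _ q2) -mulgA (groupMl _ q2T) => gp1T.
    by rewrite -groupV invMg !invgK.
  - by rewrite torsionX p1o Gauss_dvdl ?co12 // dvdnF.
(* Closedness of [G1] makes [g q2] agree with [q2] modulo [G1]. Working modulo [G1 * H2] also covers
   the error term in [gq2], and [n2 > 2 * h2] keeps [q2 ^+ 2] outside. *)
have c3_false : c3 = false.
  apply: (inv_if_unique (K := T (n1 * h2)) (x := g q2) (z := q2)).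
  - by apply: (subsetP _ _ gq2); rewrite torsionS ?dvdn_mul.
  - have p1T : p1 \in T n1 by rewrite mem_torsion p1o.
    have: g u * (g q2)^-1 \in T n1.
      by apply: etrans (gX _ G1closed q2 u) _; rewrite /u mulgK.
    rewrite gu -mulgA (groupMl _ (groupVr p1T)) => gq2T; rewrite -groupV invMg invgK.
    by apply: (subsetP _ _ gq2T); rewrite torsionS ?dvdn_mulr.
  - by rewrite torsionX q2o mulnCA Gauss_dvdr 1?coprime_sym // dvdnF ?muln_gt0.
by rewrite c12 c23 c3_false in c1_true.
Qed.
End NonSchur.

Theorem theorem2p1 (n1 n2 : nat) (gT : finGroupType)
  (n1_gt0 : 0 < n1) (n2_gt0 : 0 < n2) (co_n12 : coprime n1 n2)
  (Omega_n1 : 2 <= Omega_star n1) (Omega_n2 : 2 <= Omega_star n2)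
  (cycG : cyclic [set: gT]) (cardG : #|[set: gT]| = n1 * n2) :
  ~ Schur_group gT.
Proof.
have [h1 [d1 [h1d d1n d1h [d1_gt2 d1_lt h1_lt]]]] := Omega_star_ge2 n1_gt0 Omega_n1.
have [h2 [d2 [h2d d2n d2h [d2_gt2 d2_lt h2_lt]]]] := Omega_star_ge2 n2_gt0 Omega_n2.
exact: (@torsion_not_Schur gT n1 n2 d1 d2 h1 h2).
Qed.
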